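(* For each integer $k\ge 3$, there are infinitely many connected unweighted signed graphs $\tilde G$ such that the underlying unsigned graph has maximum degree $k$, $\tilde G$ has exactly one negative edge weight, and $\tilde G$ admits plus state transfer at time $\frac{\pi}{2}$.
   Context: An unweighted signed graph has all edge weights in $\{1,-1\}$ (with at least one of each sign); its underlying graph is obtained by replacing all weights by $1$. Its adjacency matrix $A$ has $A_{a,b}$ equal to the weight of $\{a,b\}$ (and $0$ for non-edges), and the transition matrix is $U(t)=\exp(itA)$. There is perfect state transfer between unit vectors $\mathbf u,\mathbf v$ at $\tau$ if $U(\tau)\mathbf u=\gamma\mathbf v$ for some $\gamma\in\mathbb C$. A plus state is $\frac1{\sqrt2}(\mathbf e_a+\mathbf e_b)$ with $a\ne b$; plus state transfer means perfect state transfer between two plus states that are not scalar multiples of each other. *)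

(* Defs.v *)
From HB Require Import structures.
From mathcomp Require Import all_boot all_order all_algebra.
From mathcomp Require Import complex.
From mathcomp Require Import all_classical all_reals all_analysis.

Set Implicit Arguments.
Unset Strict Implicit.
Unset Printing Implicit Defensive.

Import Order.TTheory GRing.Theory Num.Theory.
Import numFieldNormedType.Exports.

Local Open Scope ring_scope.

(* Unweighted signed graphs on {0, ..., n-1}; the edges are the pairs of
   nonzero weight, so the weight matrix is also the integer adjacency matrix. *)
Record signed_graph := SignedGraph {
  nverts : nat;
  weight : 'M[int]_nverts;
  weight_sym : forall a b, weight a b = weight b a;
  weight_diag : forall a, weight a a = 0;
  weight_edge : forall a b, weight a b != 0 -> weight a b = 1 \/ weight a b = -1;
  weight_pos : exists a b, weight a b = 1;
  weight_neg : exists a b, weight a b = -1 }.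

Section Combinatorics.

Variable G : signed_graph.

Definition adjacent : rel 'I_(nverts G) := fun a b => weight G a b != 0.

Definition connected_graph := forall a b, connect adjacent a b.

Definition degree (a : 'I_(nverts G)) : nat := #|[set b | adjacent a b]|.

Definition max_degree : nat := \max_(a < nverts G) degree a.

Definition negative_edges : {set {set 'I_(nverts G)}} :=
  [set [set p.1; p.2] | p : 'I_(nverts G) * 'I_(nverts G)
                      & weight G p.1 p.2 == -1].

End Combinatorics.

Definition isomorphic (G H : signed_graph) : Prop :=
  exists2 f : 'I_(nverts G) -> 'I_(nverts H),
    bijective f & forall a b, weight H (f a) (f b) = weight G a b.

(* The topology of the analysis library is attached to abstract numeric fields,
   so R[i] is viewed as a numClosedFieldType in order to take limits. *)
Definition Cplx (R : realType) : numClosedFieldType := R[i].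

Definition expmx (R : realType) (n : nat) (M : 'M[Cplx R]_n) : 'M[Cplx R]_n :=
  limn (fun N : nat => \sum_(0 <= k < N) (k`!%:R)^-1 *: M ^+ k).

Section StateTransfer.

Variables (R : realType) (G : signed_graph).

Local Notation C := (Cplx R).
Local Notation n := (nverts G).

Definition adjmx : 'M[C]_n := map_mx intr (weight G).

Definition transition (t : R) : 'M[C]_n := expmx ((0 +i* t)%C *: adjmx).

Definition unit_vector (u : 'cV[C]_n) : Prop := \sum_a `|u a 0| ^+ 2 = 1.

Definition perfect_state_transfer (u v : 'cV[C]_n) (tau : R) : Prop :=
  [/\ unit_vector u, unit_vector v &
      exists gamma : C, transition tau *m u = gamma *: v].

Definition basis_vector (a : 'I_n) : 'cV[C]_n := delta_mx a 0.

Definition plus_state (u : 'cV[C]_n) : Prop :=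
  exists a b : 'I_n, a != b /\
    u = (sqrtC 2)^-1 *: (basis_vector a + basis_vector b).

Definition plus_state_transfer (tau : R) : Prop :=
  exists u v : 'cV[C]_n,
    [/\ plus_state u, plus_state v,
        ~ (exists c : C, u = c *: v \/ v = c *: u) &
        perfect_state_transfer u v tau].

End StateTransfer.

(* Main.v *)
(* If the neighbourhoods of two vertices a, b satisfy A(e_a + e_b) = e_c + e_d
   and A(e_c + e_d) = e_a + e_b, then U(t)(e_a + e_b) = cos t (e_a + e_b)
   + i sin t (e_c + e_d), which gives plus state transfer at time pi/2. This
   happens when c, d are leaves hanging from a, b respectively and the only
   other neighbour of a and b is a common vertex x with edges of opposite signs:
   the contributions of a and b at x cancel, and the rest of the graph, attached
   at x, can be chosen freely. Here x gets k - 2 further neighbours, one of which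
   is the start of a path of arbitrary length. *)
Require Import Defs.
From mathcomp Require Import all_boot all_order all_algebra.
From mathcomp Require Import complex.
From mathcomp Require Import all_classical all_reals all_analysis.
From mathcomp Require Import zify.
Import Order.TTheory GRing.Theory Num.Theory.
Import numFieldNormedType.Exports.
Local Open Scope ring_scope.

(** * Limits of complex sequences and of matrices *)

Section Analysis.
Local Open Scope classical_set_scope.

Lemma cvg_real_complex (R : realType) (u : nat -> R) (l : R) :
  u @ \oo --> l -> (fun N => (u N)%:C%C : Cplx R) @ \oo --> (l%:C%C : Cplx R).
Proof.
move=> /cvgrPdist_lt ul; apply/cvgrPdist_lt => e e0.
(* In the partial order on complex numbers a positive [e] is real. *)
have eR : e = (complex.Re e)%:C%C by rewrite RRe_real// realE ltW.
have e0' : 0 < complex.Re e by move: e0; rewrite eR ltcR.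
near=> N; rewrite eR -rmorphB normc_def /= expr0n addr0 sqrtr_sqr ltcR.
by near: N; exact: ul.
Unshelve. all: by end_near. Qed.

Lemma cvg_complex (R : realType) (u v : nat -> R) (a b : R) :
  u @ \oo --> a -> v @ \oo --> b ->
  (fun N => (u N +i* v N)%C : Cplx R) @ \oo --> ((a +i* b)%C : Cplx R).
Proof.
move=> ua vb.
have E x y : (x +i* y)%C = x%:C%C + 'i%C * y%:C%C :> Cplx R.
  exact: (complexE (x +i* y)%C).
under eq_fun do rewrite E.
rewrite E; apply: cvgD; first exact: cvg_real_complex.
by apply: cvgM; [exact: cvg_cst | exact: cvg_real_complex].
Qed.

Lemma cvg_mx_entries (K : numFieldType) m n (u : nat -> 'M[K]_(m, n))
    (l : 'M[K]_(m, n)) :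
  u @ \oo --> l <-> forall a b, (fun N => u N a b) @ \oo --> l a b.
Proof.
split=> [ul a b A lA|ul A [P Pl PA]].
  apply: (ul [set M : 'M[K]_(m, n) | A (M a b)]).
  (* This family of entry neighbourhoods constrains only the entry at [a], [b]. *)
  exists (fun i j => [set x | (i == a) && (j == b) -> A x]).
    move=> i j /=; case: andP => [[/eqP -> /eqP ->]|_].
      by apply: filterS lA => x Ax _.
    by apply: filterS filterT.
  by move=> M /(_ a b) /=; rewrite !eqxx; exact.
have nP : \forall N \near \oo, forall i j, P i j (u N i j).
  by apply: filter_forall => i; apply: filter_forall => j; apply: ul; exact: Pl.
by apply: filterS nP => N; exact: PA.
Qed.

(** * Convergence of the matrix exponential series *)

Section Expmx.
Variables (R : realType) (n : nat).
Local Notation C := (Cplx R).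
Implicit Types M : 'M[C]_n.

Lemma mx_expr_bound M :
  exists B : R, 0 <= B /\ forall k a b, `|(M ^+ k) a b| <= (B ^+ k)%:C%C :> C.
Proof.
(* The sum of all absolute values dominates every column sum, which is what each further factor [M]
   costs. *)
pose B : C := \sum_a \sum_b `|M a b|.
have B0 : 0 <= B by do 2![apply: sumr_ge0 => ? _].
have BE : B = (complex.Re B)%:C%C by rewrite RRe_real// realE B0.
exists (complex.Re B); split; first by move: B0; rewrite {1}BE lecR.
move=> k a b; rewrite rmorphXn /= -BE.
elim: k a b => [|k IH] a b.
  by rewrite !expr0 mxE; case: (a == b); rewrite ?normr1 ?normr0 ?ler01.
rewrite exprSr -mulmxE mxE (le_trans (ler_norm_sum _ _ _))//.
rewrite exprSr; apply: le_trans (_ : B ^+ k * \sum_c `|M c b| <= _).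
  by rewrite mulr_sumr ler_sum// => c _; rewrite normrM ler_wpM2r.
rewrite ler_wpM2l ?exprn_ge0// ler_sum// => c _.
by rewrite (bigD1 b)//= lerDl sumr_ge0.
Qed.

(** Real and imaginary parts of each entry are dominated by the exponential series of the bound [B].
    This makes [expmx] a genuine limit. *)
Lemma is_cvg_expmx_series M :
  cvgn (fun N : nat => \sum_(0 <= k < N) (k`!%:R)^-1 *: M ^+ k).
Proof.
have [B [B0 MB]] := mx_expr_bound M.
have dom (f : nat -> R) : (forall k, `|f k| <= exp_coeff B k) -> cvgn (series f).
  move=> fB; apply: normed_cvg; apply: series_le_cvg fB (is_cvg_series_exp_coeff B).
    by move=> k /=.
  by move=> k; rewrite divr_ge0 ?exprn_ge0.
have Mc a b k : `|((k`!%:R)^-1 *: M ^+ k) a b| <= (exp_coeff B k)%:C%C.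
  rewrite mxE normrM normfV normr_nat /exp_coeff /= rmorphM fmorphV rmorph_nat.
  by rewrite mulrC ler_wpM2r// invr_ge0.
pose re a b := series (fun k => complex.Re (((k`!%:R)^-1 *: M ^+ k) a b)).
pose im a b := series (fun k => complex.Im (((k`!%:R)^-1 *: M ^+ k) a b)).
have cre a b : cvgn (re a b).
  by apply: dom => k; rewrite -lecR (le_trans (normc_ge_Re _)).
have cim a b : cvgn (im a b).
  apply: dom => k; rewrite -lecR (le_trans _ (Mc a b k))//.
  by rewrite normc_def lecR -sqrtr_sqr ler_wsqrtr// lerDr sqr_ge0.
apply/cvg_ex; exists (\matrix_(a, b) (limn (re a b) +i* limn (im a b))%C).
apply/cvg_mx_entries => a b; rewrite mxE.
rewrite (_ : (fun N => _) = fun N => (re a b N +i* im a b N)%C).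
  exact: cvg_complex.
apply/funext => N; rewrite summxE /re /im /series /=.
elim: N => [|N IH]; first by rewrite !big_geq.
by rewrite !big_nat_recr//= IH; case: (X in _ + X = _).
Qed.

(** Each entry of the product is a finite sum, so multiplication by [u] passes to the limit. The
    exponential can thus be evaluated on one vector alone. *)
Lemma expmx_mul_cvg M (u v : 'cV[C]_n) :
  (fun N : nat => (\sum_(0 <= k < N) (k`!%:R)^-1 *: M ^+ k) *m u) @ \oo --> v ->
  expmx M *m u = v.
Proof.
move=> Mv; have /cvg_mx_entries Ml : _ --> expmx M := is_cvg_expmx_series M.
move/cvg_mx_entries in Mv.
apply/colP => a; rewrite mxE; apply/esym.
have := Mv a 0; under eq_fun do rewrite mxE.
have Lu : (fun N => \sum_b (\sum_(0 <= k < N) (k`!%:R)^-1 *: M ^+ k) a b * u b 0)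
    @ \oo --> \sum_b expmx M a b * u b 0.
  apply: (@cvg_big C).
    by move=> x; apply: cvgD; [exact: cvg_fst | exact: cvg_snd].
  by move=> b _; apply: cvgM; [exact: Ml | exact: cvg_cst].
by move=> Mva; apply: (cvg_unique _ Mva Lu).
Qed.

End Expmx.

Lemma cvg_lin_comb (K : numFieldType) m n (u v : 'M[K]_(m, n))
    (x y : nat -> K) (a b : K) :
  x @ \oo --> a -> y @ \oo --> b ->
  (fun N => x N *: u + y N *: v) @ \oo --> a *: u + b *: v.
Proof.
move=> xa yb; apply/cvg_mx_entries => i j; rewrite !mxE.
under eq_fun do rewrite !mxE.
by apply: cvgD; apply: cvgM => //; exact: cvg_cst.
Qed.

(** Euler's formula term by term: [k] even gives the cosine term and [k] odd the sine term, with
    signs from i^2 = -1. *)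
Lemma exprIm_coeff (R : realType) (t : R) (k : nat) :
  (k`!%:R)^-1 * (0 +i* t)%C ^+ k
    = (cos_coeff t k)%:C%C + 'i%C * (sin_coeff t k)%:C%C :> R[i].
Proof.
have -> : (0 +i* t)%C = 'i%C * t%:C%C :> R[i] by rewrite [LHS]complexE /= add0r.
have ik : 'i%C ^+ k = 'i%C ^+ odd k * (-1) ^+ k./2 :> R[i].
  by rewrite -{1}(odd_double_half k) exprD -mul2n exprM sqr_i.
rewrite exprMn ik /cos_coeff /sin_coeff /= !rmorphM !fmorphV !rmorph_nat !rmorphXn.
rewrite !rmorphN !rmorph1 /=.
have [ok|ek] /= := boolP (odd k).
  (* The sine coefficient carries the exponent [k.-1./2], which agrees with [k./2] only for odd
     [k]. *)
  have -> : k.-1./2 = k./2.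
    by move: ok; case: k {ik} => //= k; rewrite uphalf_half => /negbTE ->.
  by rewrite !mul0r !mul1r add0r expr1 -!mulrA mulrC -!mulrA.
by rewrite !mul0r mulr0 addr0 !mul1r -!mulrA mulrC -!mulrA.
Qed.

(** * Exponential of a matrix that swaps two vectors *)

Section Swap.
Variables (R : realType) (n : nat) (A : 'M[Cplx R]_n) (u v : 'cV[Cplx R]_n).
Hypotheses (Au : A *m u = v) (Av : A *m v = u).

Lemma expr_swap (c : Cplx R) k :
  (c *: A) ^+ k *m u = c ^+ k *: (if odd k then v else u).
Proof.
elim: k => [|k IH]; first by rewrite !expr0 mul1mx scale1r.
rewrite exprS -mulmxE -mulmxA IH -scalemxAr -scalemxAl scalerA -exprSr /=.
by case: odd; rewrite /= ?Au ?Av.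
Qed.

Lemma exp_term_swap (t : R) k :
  ((k`!%:R)^-1 *: ((0 +i* t)%C *: A) ^+ k) *m u
    = (cos_coeff t k)%:C%C *: u + ('i * (sin_coeff t k)%:C)%C *: v.
Proof.
(* The parity that selects [u] or [v] also kills the coefficient of the other vector. *)
rewrite -scalemxAl expr_swap scalerA exprIm_coeff.
have [ok|ok] := boolP (odd k).
  have -> : cos_coeff t k = 0 by rewrite /cos_coeff /= ok !mul0r.
  by rewrite rmorph0 scale0r !add0r.
have -> : sin_coeff t k = 0 by rewrite /sin_coeff /= (negbTE ok) !mul0r.
by rewrite rmorph0 mulr0 scale0r !addr0.
Qed.

Lemma expmx_swap (t : R) :
  expmx ((0 +i* t)%C *: A) *m u
    = (cos t)%:C%C *: u + ('i * (sin t)%:C)%C *: v.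
Proof.
apply: expmx_mul_cvg.
rewrite (_ : (fun N => _) = fun N => (series (cos_coeff t) N)%:C%C *: u
   + ('i * (series (sin_coeff t) N)%:C)%C *: v); last first.
  apply/funext => N; rewrite mulmx_suml.
  under eq_bigr do rewrite exp_term_swap.
  by rewrite big_split /= -!scaler_suml -mulr_sumr !rmorph_sum.
apply: cvg_lin_comb.
  (* Unlocked, [cos t] is the limit of this series; likewise [sin t] below. *)
  by apply: cvg_real_complex; rewrite unlock; exact: is_cvg_series_cos_coeff.
apply: cvgM; first exact: cvg_cst.
by apply: cvg_real_complex; rewrite unlock; exact: is_cvg_series_sin_coeff.
Qed.

End Swap.

End Analysis.

(** * Plus states and their transfer *)

Section PlusStates.
Variables (R : realType) (G : signed_graph).
Local Notation e := (@basis_vector R G).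
Local Notation C := (Cplx R).

Lemma unit_plus_state (u : 'cV[C]_(nverts G)) : plus_state u -> unit_vector u.
Proof.
move=> [a [b [ab ->]]].
have s2 : `|(sqrtC 2)^-1 : C| ^+ 2 = 2^-1.
  by rewrite -normrX exprVn sqrtCK normfV normr_nat.
rewrite /unit_vector (bigD1 a)//= (bigD1 b) 1?eq_sym//= big1 => [|c /andP[ca cb]].
  rewrite !mxE !eqxx (negbTE ab) eq_sym (negbTE ab) /= addr0 add0r mulr1 s2 addr0.
  by rewrite -[LHS]mulr2n -[LHS]mulr_natr mulVf// pnatr_eq0.
by rewrite !mxE (negbTE ca) (negbTE cb) addr0 mulr0 normr0 expr0n.
Qed.

Lemma plus_state_transfer_swap (a b c d : 'I_(nverts G)) :
  uniq [:: a; b; c; d] ->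
  (forall x, weight G x a + weight G x b = (x == c)%:R + (x == d)%:R) ->
  (forall x, weight G x c + weight G x d = (x == a)%:R + (x == b)%:R) ->
  plus_state_transfer G (pi / 2 : R).
Proof.
rewrite /= !inE !negb_or => /and4P[/and3P[ab ac ad] /andP[bc bd] cd _] wab wcd.
have adjE (x y z t : 'I_(nverts G)) :
    (forall r, weight G r x + weight G r y = (r == z)%:R + (r == t)%:R) ->
    adjmx R G *m (e x + e y) = e z + e t.
  move=> w; apply/colP => r; rewrite mulmxDr -!colE !mxE -rmorphD w rmorphD /=.
  by rewrite !andbT !rmorph_nat.
pose s : C := (sqrtC 2)^-1.
have s0 : s != 0 by rewrite invr_eq0 sqrtC_eq0 pnatr_eq0.
have pu : plus_state (R := R) (G := G) (s *: (e a + e b)) by exists a, b.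
have pv : plus_state (R := R) (G := G) (s *: (e c + e d)) by exists c, d.
exists (s *: (e a + e b)), (s *: (e c + e d)); split=> //.
  (* Proportionality fails at entry [a], resp. [c]: one side is the nonzero [s], the other is 0. *)
  move=> [x [/colP/(_ a)|/colP/(_ c)]] /eqP; rewrite !mxE !eqxx.
    by rewrite (negbTE ab) (negbTE ac) (negbTE ad) !addr0 mulr0 mulr1 mulr0 (negbTE s0).
  rewrite (negbTE cd) ![c == _]eq_sym (negbTE ac) (negbTE bc).
  by rewrite !addr0 mulr0 mulr1 mulr0 (negbTE s0).
split; [exact: unit_plus_state | exact: unit_plus_state |].
exists ('i%C); rewrite /transition -scalemxAr.
rewrite (expmx_swap _ _ _ _ _ (adjE _ _ _ _ wab) (adjE _ _ _ _ wcd)).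
by rewrite cos_pihalf sin_pihalf rmorph0 scale0r add0r rmorph1 mulr1 !scalerA mulrC.
Qed.

End PlusStates.

(** * The signed tree on the natural numbers *)

Section Tree.
Local Open Scope nat_scope.
Variable d : nat.

(* The tree for k = d + 3, rooted at x = 0: the children of 0 are 1, 2 and
   5, ..., d + 5; leaves 3 and 4 hang from 1 and 2; and d + 5, d + 6, ... is a path.
   The weight -1 sits on the only edge with vertex sum 2, namely {0, 2}. *)
Definition tree_parent (j : nat) :=
  if j <= 2 then 0 else if j <= 4 then j - 2 else if j <= d + 5 then 0 else j.-1.

(** The root is its own parent, so [a != b] removes a loop at 0. *)
Definition tree_edge : rel nat :=
  fun a b => (a != b) && ((a == tree_parent b) || (b == tree_parent a)).

Definition tree_weight (a b : nat) : int :=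
  if tree_edge a b then if a + b == 2 then (-1)%R else 1%R else 0%R.

Lemma tree_parent_lt (j : nat) : 0 < j -> tree_parent j < j.
Proof. by rewrite /tree_parent; repeat (case: ifP => //=); lia. Qed.

Lemma tree_edge_sym : symmetric tree_edge.
Proof. by move=> a b; rewrite /tree_edge eq_sym orbC. Qed.

Lemma tree_weight_sym a b : tree_weight a b = tree_weight b a.
Proof. by rewrite /tree_weight tree_edge_sym addnC. Qed.

Lemma tree_edge0 b :
  tree_edge 0 b = (b == 1) || (b == 2) || (4 < b <= d + 5).
Proof. by rewrite /tree_edge /tree_parent /=; repeat (case: ifP => //=); lia. Qed.

(** Besides its parent, a vertex other than the root has at most one neighbour: its leaf, or the
    next vertex of the path. Hence its degree is at most 2. *)
Lemma tree_edge_pos a b : 0 < a -> tree_edge a b ->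
  b \in [:: tree_parent a; if a <= 2 then a + 2 else a.+1].
Proof. by rewrite /tree_edge /tree_parent !inE; repeat (case: ifP => //=); lia. Qed.

Lemma tree_weight_neg a b :
  (tree_weight a b == -1%R) = ((a == 0) && (b == 2) || (a == 2) && (b == 0)).
Proof. by rewrite /tree_weight /tree_edge /tree_parent; repeat (case: ifP => //=); lia. Qed.

(** At the root the weights 1 and -1 cancel; only the leaves 3 and 4 remain. *)
Lemma tree_weight12 x :
  (tree_weight x 1 + tree_weight x 2 = (x == 3%N)%:R + (x == 4%N)%:R)%R.
Proof. by rewrite /tree_weight /tree_edge /tree_parent; repeat (case: ifP => //=); lia. Qed.

Lemma tree_weight34 x :
  (tree_weight x 3 + tree_weight x 4 = (x == 1%N)%:R + (x == 2%N)%:R)%R.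
Proof. by rewrite /tree_weight /tree_edge /tree_parent; repeat (case: ifP => //=); lia. Qed.

End Tree.

(** * Finite truncations of the tree as signed graphs *)

Section TreeGraph.
Variables d i : nat.

(** All children of the root, the last being [d + 5], are kept, followed by [i] more path
    vertices. *)
Local Notation n := (d + i).+4.+2.

Definition tree_mx : 'M[int]_n := \matrix_(a, b) tree_weight d a b.

Lemma tree_mx_sym a b : tree_mx a b = tree_mx b a.
Proof. by rewrite !mxE tree_weight_sym. Qed.

Lemma tree_mx_diag a : tree_mx a a = 0.
Proof. by rewrite mxE /tree_weight /tree_edge eqxx. Qed.

Lemma tree_mx_edge a b : tree_mx a b != 0 -> tree_mx a b = 1 \/ tree_mx a b = -1.
Proof. by rewrite mxE /tree_weight; do 2?case: ifP; auto. Qed.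

Lemma tree_mx_pos : exists a b, tree_mx a b = 1.
Proof. by exists (inord 0), (inord 1); rewrite mxE !inordK. Qed.

Lemma tree_mx_neg : exists a b, tree_mx a b = -1.
Proof. by exists (inord 0), (inord 2); rewrite mxE !inordK. Qed.

Definition tree_graph : signed_graph :=
  SignedGraph tree_mx_sym tree_mx_diag tree_mx_edge tree_mx_pos tree_mx_neg.

Lemma tree_adjacent (a b : 'I_n) : @Defs.adjacent tree_graph a b = tree_edge d a b.
Proof. by rewrite /Defs.adjacent /= mxE /tree_weight; do 2?case: ifP. Qed.

Lemma tree_connected : connected_graph tree_graph.
Proof.
have cs : connect_sym (@Defs.adjacent tree_graph).
  by apply: sym_connect_sym => a b; rewrite !tree_adjacent tree_edge_sym.
(* Passing to the parent lowers the index, so induction on a bound [m] reaches the root. *)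
have c0 (m : nat) (a : 'I_n) : (a < m)%N -> connect (@Defs.adjacent tree_graph) a ord0.
  elim: m a => // m IH a am.
  have [a0|a0] := posnP a; first by rewrite (_ : a = ord0)//; exact/val_inj.
  have pa := tree_parent_lt d _ a0.
  have pn : (tree_parent d a < n)%N by apply: leq_trans pa (ltnW _).
  apply: (@connect_trans _ _ (Ordinal pn)); last by apply: IH; exact: leq_trans pa _.
  by apply: connect1; rewrite tree_adjacent /tree_edge /= eqxx orbT andbT gtn_eqF.
move=> a b; apply: (@connect_trans _ _ ord0); first exact: c0.
by rewrite cs; exact: c0.
Qed.

Lemma tree_max_degree : max_degree tree_graph = d.+3.
Proof.
have deg0 : @degree tree_graph ord0 = d.+3.
  rewrite /degree -sum1dep_card; under eq_bigl do rewrite tree_adjacent.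
  rewrite -(big_mkord (tree_edge d 0) (fun=> 1%N)) sum1_count /index_iota subn0.
  (* Three blocks of vertices: 0 to 4 contain the neighbours 1 and 2 of the root, the next [d.+1]
     are all neighbours, the last [i] are not. *)
  rewrite (_ : nverts tree_graph = (5 + (d.+1 + i))%N); last by rewrite /=; lia.
  have c1 : count (tree_edge d 0) (iota 5 d.+1) = d.+1.
    rewrite (@eq_in_count _ _ predT) ?count_predT ?size_iota// => b.
    by rewrite mem_iota tree_edge0 /=; lia.
  have c2 : count (tree_edge d 0) (iota (5 + d.+1) i) = 0%N.
    rewrite (@eq_in_count _ _ pred0) ?count_pred0// => b.
    by rewrite mem_iota tree_edge0 /=; lia.
  by rewrite !iotaD !count_cat !add0n c1 c2 addn0.
apply/eqP; rewrite eqn_leq; apply/andP; split; last first.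
  by rewrite -deg0; exact: leq_bigmax.
apply/bigmax_leqP => a _; have [a0|a0] := posnP a.
  by rewrite (_ : a = ord0) ?deg0//; exact/val_inj.
apply: (@leq_trans 2) => //; rewrite /degree cardE -(size_map val).
apply: (uniq_leq_size _ (s2 := [:: tree_parent d a; if a <= 2 then a + 2 else a.+1]%N)).
  by rewrite map_inj_uniq ?enum_uniq//; exact: val_inj.
move=> _ /mapP[b + ->]; rewrite mem_enum inE tree_adjacent.
exact: tree_edge_pos.
Qed.

Lemma tree_negative_edges : #|negative_edges tree_graph| = 1%N.
Proof.
rewrite (_ : negative_edges tree_graph = [set [set inord 0; inord 2]]) ?cards1//.
apply/setP => E; rewrite !inE; apply/imsetP/eqP => [[[a b]]|->]; last first.
  by exists (inord 0, inord 2); rewrite // inE /= mxE !inordK.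
rewrite inE /= mxE tree_weight_neg.
(* The two orientations of the edge give the same set. *)
by case/orP => /andP[/eqP ha /eqP hb] ->;
  rewrite -[a]inord_val -[b]inord_val ha hb // finset.setUC.
Qed.

End TreeGraph.

Lemma tree_plus_state_transfer (R : realType) (d i : nat) :
  plus_state_transfer (tree_graph d i) (pi / 2 : R).
Proof.
(* There are at least 6 vertices, so [inord] is faithful on the indices 1 to 4 used below. *)
have vE (x : 'I_(nverts (tree_graph d i))) (j : nat) :
    (j < 6)%N -> (x == @inord (d + i).+4.+1 j) = (val x == j).
  by move=> j6; rewrite -val_eqE /= inordK// (leq_trans j6).
pose o j : 'I_(nverts (tree_graph d i)) := @inord (d + i).+4.+1 j.
apply: (@plus_state_transfer_swap R (tree_graph d i) (o 1%N) (o 2%N) (o 3%N) (o 4%N)).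
- by rewrite /= !inE -!val_eqE /= !inordK.
- by move=> x; rewrite !vE// /= !mxE !inordK// tree_weight12.
- by move=> x; rewrite !vE// /= !mxE !inordK// tree_weight34.
Qed.

Theorem theorem5p3 (R : realType) (k : nat) (hk : (3 <= k)%N) :
  exists G : nat -> signed_graph,
    (forall i j : nat, i <> j -> ~ isomorphic (G i) (G j)) /\
    (forall i : nat,
       [/\ connected_graph (G i),
           max_degree (G i) = k,
           #|negative_edges (G i)| = 1%N &
           plus_state_transfer (G i) (pi / 2 : R)]).
Proof.
(* The root has degree [d + 3], whence [d = k - 3]; different [i] give different numbers of
   vertices, so no two of the graphs are isomorphic. *)
exists (tree_graph (k - 3)); split=> [i j ij [f /bij_eq_card + _]|i].
  by rewrite !card_ord /= => -[] /addnI.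
split; [exact: tree_connected | | exact: tree_negative_edges |].
  by rewrite tree_max_degree -addn3 subnK.
exact: tree_plus_state_transfer.
Qed.
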